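(* Let $p\ge2$ be an integer, $q=e^{i\pi/p}$ (with $i$ here the imaginary unit), and let $1\le i\le p-1$ be an integer. Let $\Phi:X^{\otimes(2p-i-1)}\to\mathcal{P}^+_i\to\mathcal{P}^+_i\to X^{\otimes(2p-i-1)}$ be the second endomorphism of the summand $\mathcal{P}^+_i$ of $X^{\otimes(2p-i-1)}$, i.e. the composite of the projection, the endomorphism $b_k\mapsto a_k$, $a_k,x_j,y_j\mapsto0$ of $\mathcal{P}_i^+$, and the inclusion, as described in the context. Then, up to a nonzero constant, $\Phi$ is given diagrammatically by $$(f_{p-1}\otimes1^{\otimes(p-i)})\,(1^{\otimes(i-1)}\otimes\cap^{(p-i)}\cup^{(p-i)})\,(f_{p-1}\otimes1^{\otimes(p-i)}).$$
   Context: $\bar U_q(\mathfrak{sl}_2)$ is the Hopf algebra over a field $\mathbb{K}$ (containing $q$, e.g. $\mathbb{C}$) generated by $E,F,K$ with $KEK^{-1}=q^2E$, $KFK^{-1}=q^{-2}F$, $EF-FE=\frac{K-K^{-1}}{q-q^{-1}}$, $E^p=F^p=0$, $K^{2p}=1$, $\Delta E=E\otimes K+1\otimes E$, $\Delta F=F\otimes 1+K^{-1}\otimes F$, $\Delta K=K\otimes K$. Put $[n]=\frac{q^n-q^{-n}}{q-q^{-1}}$, $[n]!=[1]\cdots[n]$. $X=\mathcal{X}^+_2$ has basis $\nu_0,\nu_1$ with $K\nu_0=q\nu_0$, $K\nu_1=q^{-1}\nu_1$, $E\nu_0=0$, $E\nu_1=\nu_0$, $F\nu_0=\nu_1$, $F\nu_1=0$.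 For $1\le i_1<\dots<i_n\le z$, $\rho_{i_1,\dots,i_n,z}\in X^{\otimes z}$ is the basis tensor with $\nu_1$ in positions $i_1,\dots,i_n$ and $\nu_0$ elsewhere; $x_{0,z}=\nu_0^{\otimes z}$. $\mathcal{P}^+_i$ is the $2p$-dimensional indecomposable projective module with basis $\{a_k,b_k\}_{0\le k\le i-1}\cup\{x_j,y_j\}_{0\le j\le p-i-1}$ and action $Ka_k=q^{i-1-2k}a_k$, $Kb_k=q^{i-1-2k}b_k$, $Kx_j=-q^{p-i-1-2j}x_j$, $Ky_j=-q^{p-i-1-2j}y_j$; $Ea_k=[k][i-k]a_{k-1}$, $Eb_k=[k][i-k]b_{k-1}+a_{k-1}$ ($k\ge1$), $Eb_0=x_{p-i-1}$, $Ex_j=-[j][p-i-j]x_{j-1}$, $Ey_j=-[j][p-i-j]y_{j-1}$ ($j\ge1$), $Ey_0=a_{i-1}$; $Fa_k=a_{k+1}$, $Fb_k=b_{k+1}$ ($k<i-1$), $Fb_{i-1}=y_0$, $Fx_j=x_{j+1}$ ($j<p-i-1$), $Fx_{p-i-1}=a_0$, $Fy_j=y_{j+1}$, with $x_{-1}=a_{-1}=a_i=y_{p-i}=0$. The projection $X^{\otimes(2p-i-1)}\to\mathcal{P}^+_i$ is, modulo the span of the $a_k,x_j,y_j$, given for $p-i\le n\le p-1$ by $$\rho_{i_1,\dots,i_n,2p-i-1}\mapsto(-1)^{p-i-1}q^{\,n(2p-i-1)-\frac12(n^2-n)-\sum_{j=1}^n i_j}\,\frac{[n]!\,[p-n-1]!}{[n+i-p]!\,[i-1]!\,([p-i-1]!)^2}\;b_{n+i-p},$$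 and by $0$ for all other $n$. The inclusion $\mathcal{P}^+_i\to X^{\otimes(2p-i-1)}$ satisfies $a_n\mapsto F^{n+p-i}x_{0,2p-i-1}$. Only these data enter in $\Phi$. Diagrams act as follows (composition right to left, $1$ is the identity strand): $\cup:X\otimes X\to\mathbb{K}$, $\cup(\nu_0\otimes\nu_0)=\cup(\nu_1\otimes\nu_1)=0$, $\cup(\nu_0\otimes\nu_1)=-q$, $\cup(\nu_1\otimes\nu_0)=1$; $\cap:\mathbb{K}\to X\otimes X$, $\cap(1)=q^{-1}\nu_1\otimes\nu_0-\nu_0\otimes\nu_1$. $\cup^{(m)}:X^{\otimes2m}\to\mathbb{K}$ and $\cap^{(m)}:\mathbb{K}\to X^{\otimes2m}$ are the nested $m$-fold versions, pairing position $k$ with position $2m+1-k$. $f_n$ is the Jones–Wenzl projection on $X^{\otimes n}$ (for $n\le p-1$): $f_1=1$, $f_n=f_{n-1}\otimes1-\frac{[n-1]}{[n]}(f_{n-1}\otimes1)\mathbf{e}_{n-1}(f_{n-1}\otimes1)$, where $\mathbf{e}_k=1^{\otimes(k-1)}\otimes\cap\cup\otimes1^{\otimes(n-k-1)}$. *)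

(* Defs.v *)
From HB Require Import structures.
From mathcomp Require Import all_boot all_order all_algebra.
From mathcomp Require Import complex reals trigo.
Set Implicit Arguments.
Unset Strict Implicit.
Unset Printing Implicit Defensive.
Import Order.TTheory GRing.Theory Num.Theory.
Local Open Scope ring_scope.

Definition fvec (k : fieldType) (I : finType) : vectType k := {ffun I -> k^o}.

Definition bas (k : fieldType) (I : finType) (x : I) : fvec k I :=
  [ffun y => (y == x)%:R].

Definition lext (k : fieldType) (I : finType) (V : vectType k) (g : I -> V) :
  'Hom(fvec k I, V) := linfun (fun v : fvec k I => \sum_x v x *: g x).

(* [linfun] is only meaningful on linear functions, which is the case here. *)
Lemma lextE (k : fieldType) (I : finType) (V : vectType k) (g : I -> V)
  (v : fvec k I) : lext g v = \sum_x v x *: g x.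
Proof.
pose h (v : fvec k I) := \sum_x v x *: g x.
have hlin : linear h.
  move=> a u w; rewrite /h scaler_sumr -big_split; apply: eq_bigr => x _ /=.
  by rewrite !ffunE scalerDl scalerA.
pose hL := GRing.isLinear.Build k (fvec k I) V *:%R h hlin.
pose h' : {linear fvec k I -> V} := HB.pack h hL.
exact: (lfunE h').
Qed.

Lemma lext_bas (k : fieldType) (I : finType) (V : vectType k) (g : I -> V)
  (x : I) : lext g (bas k x) = g x.
Proof.
rewrite lextE (bigD1 x) //= ffunE eqxx scale1r big1 ?addr0 // => y yx.
by rewrite ffunE (negPf yx) scale0r.
Qed.

Definition qint (k : fieldType) (q : k) (n : nat) : k :=
  (q ^+ n - q ^- n) / (q - q^-1).

Definition qfact (k : fieldType) (q : k) (n : nat) : k :=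
  \prod_(1 <= j < n.+1) qint q j.

(* e^(i t) *)
Definition cexpi (R : realType) (t : R) : complex R := (cos t +i* sin t)%C.

(* X^(⊗n), where the word s stands for the basis tensor having nu_1 at the
   places where s is true and nu_0 elsewhere: s is rho_(i_1,...,i_m,n) for
   i_1 < ... < i_m the (1-based) places of true in s. *)
Definition Xpow (k : fieldType) (n : nat) : vectType k :=
  fvec k (n.-tuple bool).

Definition xzero (k : fieldType) (n : nat) : Xpow k n :=
  bas k [tuple of nseq n false].

Definition window (n j a : nat) (s : n.-tuple bool) : a.-tuple bool :=
  [tuple nth false s (j + l) | l < a].

(* 1^(⊗j) ⊗ f ⊗ 1^(⊗(n-j-a)) on X^(⊗n); only meaningful for j + a <= n. *)
Definition slot (k : fieldType) (n j a : nat) (f : 'End(Xpow k a)) :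
  'End(Xpow k n) :=
  lext (fun s : n.-tuple bool => [ffun t : n.-tuple bool =>
    if [forall l : 'I_n, ((l < j) || (j + a <= l))%N ==> (tnth s l == tnth t l)]
    then (f (bas k (window j a s)) : Xpow k a) (window j a t) else 0]).

(* An action of the restricted quantum group is recorded by the operators of the generators E, F, K; the
   module homomorphisms are the linear maps commuting with these. *)

Record Uact (k : fieldType) (V : vectType k) := UAct {
  actE : 'End(V);
  actF : 'End(V);
  actK : 'End(V) }.

Definition Uhom (k : fieldType) (V W : vectType k) (A : Uact V) (B : Uact W)
  (f : 'Hom(V, W)) : Prop :=
  [/\ (f \o actE A = actE B \o f)%VF,
      (f \o actF A = actF B \o f)%VF
    & (f \o actK A = actK B \o f)%VF].

Definition X1E (k : fieldType) : 'End(Xpow k 1) :=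
  lext (fun s : 1.-tuple bool =>
    if thead s then bas k [tuple false] : Xpow k 1 else 0).

Definition X1F (k : fieldType) : 'End(Xpow k 1) :=
  lext (fun s : 1.-tuple bool =>
    if thead s then 0 else bas k [tuple true] : Xpow k 1).

(* X1K q^-1 is the action of K^-1. *)
Definition X1K (k : fieldType) (q : k) : 'End(Xpow k 1) :=
  lext (fun s : 1.-tuple bool =>
    (if thead s then q^-1 else q) *: (bas k s : Xpow k 1)).

(* X^(⊗(n+1)) = X ⊗ X^(⊗n), with Delta E = E⊗K + 1⊗E, Delta F = F⊗1 + K^-1⊗F
   and Delta K = K⊗K; the counit for n = 0. *)
Fixpoint Xact (k : fieldType) (q : k) (n : nat) : Uact (Xpow k n) :=
  match n return Uact (Xpow k n) with
  | 0 => UAct 0 0 \1%VF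
  | m.+1 =>
    let A := Xact q m in
    UAct ((slot m.+1 0 (X1E k) \o slot m.+1 1 (actK A)) + slot m.+1 1 (actE A))%VF
         (slot m.+1 0 (X1F k) + (slot m.+1 0 (X1K q^-1) \o slot m.+1 1 (actF A)))%VF
         (slot m.+1 0 (X1K q) \o slot m.+1 1 (actK A))%VF
  end.

(* Labels, in this order, of the basis vectors a_n, b_n, x_n, y_n. *)
Definition plabel (p i : nat) : finType :=
  (('I_i + 'I_i) + ('I_(p - i) + 'I_(p - i)))%type.

Definition Pplus (k : fieldType) (p i : nat) : vectType k := fvec k (plabel p i).

(* Basis vectors with index in nat: zero when the index is too large. *)
Definition Pa (k : fieldType) (p i n : nat) : Pplus k p i :=
  [ffun l : plabel p i =>
    (if l is inl (inl j) then (j == n :> nat)%:R else 0) : k^o].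
Definition Pb (k : fieldType) (p i n : nat) : Pplus k p i :=
  [ffun l : plabel p i =>
    (if l is inl (inr j) then (j == n :> nat)%:R else 0) : k^o].
Definition Px (k : fieldType) (p i n : nat) : Pplus k p i :=
  [ffun l : plabel p i =>
    (if l is inr (inl j) then (j == n :> nat)%:R else 0) : k^o].
Definition Py (k : fieldType) (p i n : nat) : Pplus k p i :=
  [ffun l : plabel p i =>
    (if l is inr (inr j) then (j == n :> nat)%:R else 0) : k^o].

(* Since qint q 0 = 0, the terms involving j.-1 vanish for j = 0, as they
   should with a_(-1) = x_(-1) = 0. *)
Definition PE (k : fieldType) (q : k) (p i : nat) : 'End(Pplus k p i) :=
  lext (fun l : plabel p i => match l with
    | inl (inl j) => (qint q j * qint q (i - j)) *: Pa k p i j.-1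
    | inl (inr j) => if j == 0%N :> nat then Px k p i (p - i - 1) else
        (qint q j * qint q (i - j)) *: Pb k p i j.-1 + Pa k p i j.-1
    | inr (inl j) => - (qint q j * qint q (p - i - j)) *: Px k p i j.-1
    | inr (inr j) => if j == 0%N :> nat then Pa k p i (i - 1) else
        - (qint q j * qint q (p - i - j)) *: Py k p i j.-1
    end).

Definition PF (k : fieldType) (p i : nat) : 'End(Pplus k p i) :=
  lext (fun l : plabel p i => match l with
    | inl (inl j) => Pa k p i j.+1
    | inl (inr j) => if j == (i - 1)%N :> nat then Py k p i 0 else Pb k p i j.+1
    | inr (inl j) => if j == (p - i - 1)%N :> nat then Pa k p i 0
                     else Px k p i j.+1
    | inr (inr j) => Py k p i j.+1
    end).

Definition PK (k : fieldType) (q : k) (p i : nat) : 'End(Pplus k p i) :=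
  lext (fun l : plabel p i => match l with
    | inl (inl j) => q ^ (i%:Z - 1 - 2 * j%:Z) *: Pa k p i j
    | inl (inr j) => q ^ (i%:Z - 1 - 2 * j%:Z) *: Pb k p i j
    | inr (inl j) => - q ^ (p%:Z - i%:Z - 1 - 2 * j%:Z) *: Px k p i j
    | inr (inr j) => - q ^ (p%:Z - i%:Z - 1 - 2 * j%:Z) *: Py k p i j
    end).

Definition Pact (k : fieldType) (q : k) (p i : nat) : Uact (Pplus k p i) :=
  UAct (PE q p i) (PF k p i) (PK q p i).

(* The second endomorphism: b_j |-> a_j, and a_j, x_j, y_j |-> 0. *)
Definition Pnil (k : fieldType) (p i : nat) : 'End(Pplus k p i) :=
  lext (fun l : plabel p i => if l is inl (inr j) then Pa k p i j else 0).

Definition Paxy (k : fieldType) (p i : nat) : {vspace Pplus k p i} :=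
  <<[seq Pa k p i j | j <- iota 0 i] ++
    [seq Px k p i j | j <- iota 0 (p - i)] ++
    [seq Py k p i j | j <- iota 0 (p - i)]>>%VS.

(* Coefficient of b_(n+i-p) in the projection of the basis tensor s, where n is
   the number of places of true in s; 'C(n, 2) = (n^2 - n)/2. *)
Definition proj_coef (k : fieldType) (q : k) (p i z : nat) (s : z.-tuple bool) :
  k :=
  let n := count id s in
  (-1) ^+ (p - i - 1)
  * q ^ ((n * (2 * p - i - 1))%:Z - 'C(n, 2)%:Z
         - (\sum_(j < z | tnth s j) j.+1)%:Z)
  * (qfact q n * qfact q (p - n - 1)
     / (qfact q (n + i - p) * qfact q (i - 1) * qfact q (p - i - 1) ^+ 2)).

Definition is_projection (k : fieldType) (q : k) (p i : nat)
  (f : 'Hom(Xpow k (2 * p - i - 1), Pplus k p i)) : Prop :=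
  Uhom (Xact q (2 * p - i - 1)) (Pact q p i) f /\
  forall s : (2 * p - i - 1).-tuple bool,
    let n := count id s in
    f (bas k s) - (if (p - i <= n <= p - 1)%N
                   then proj_coef q p i s *: Pb k p i (n + i - p) else 0)
      \in Paxy k p i.

Definition is_inclusion (k : fieldType) (q : k) (p i : nat)
  (g : 'Hom(Pplus k p i, Xpow k (2 * p - i - 1))) : Prop :=
  Uhom (Pact q p i) (Xact q (2 * p - i - 1)) g /\
  forall n : nat, (n < i)%N ->
    g (Pa k p i n) =
      iter (n + p - i) (actF (Xact q (2 * p - i - 1))) (xzero k (2 * p - i - 1)).

(* Value of cup (nu_a ⊗ nu_b) *)
Definition cup2 (k : fieldType) (q : k) (a b : bool) : k :=
  match a, b with false, true => - q | true, false => 1 | _, _ => 0 end.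

(* Coefficient of nu_a ⊗ nu_b in cap 1 *)
Definition cap2 (k : fieldType) (q : k) (a b : bool) : k :=
  match a, b with true, false => q^-1 | false, true => -1 | _, _ => 0 end.

(* Nested cups: place l + 1 is paired with place 2m - l, for 0 <= l < m. *)
Definition cups (k : fieldType) (q : k) (m : nat) : 'Hom(Xpow k (2 * m), k^o) :=
  lext (fun s : (2 * m).-tuple bool =>
    \prod_(l < m) cup2 q (nth false s l) (nth false s (2 * m - 1 - l)) : k^o).

Definition caps (k : fieldType) (q : k) (m : nat) : 'Hom(k^o, Xpow k (2 * m)) :=
  linfun (fun c : k^o => c *: ([ffun t : (2 * m).-tuple bool =>
    \prod_(l < m) cap2 q (nth false t l) (nth false t (2 * m - 1 - l))]
    : Xpow k (2 * m))).

(* cap^(m) cup^(m) *)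
Definition capcup (k : fieldType) (q : k) (m : nat) : 'End(Xpow k (2 * m)) :=
  (caps q m \o cups q m)%VF.

(* The Jones-Wenzl projection f_n; slot n.+2 n (capcup q 1) is e_(n+1). *)
Fixpoint JW (k : fieldType) (q : k) (n : nat) : 'End(Xpow k n) :=
  match n return 'End(Xpow k n) with
  | 0 => \1%VF
  | m.+1 =>
    match m return 'End(Xpow k m) -> 'End(Xpow k m.+1) with
    | 0 => fun=> \1%VF
    | l.+1 => fun f =>
      let g := slot l.+2 0 f in
      g - (qint q l.+1 / qint q l.+2)
            *: (g \o slot l.+2 l (capcup q 1) \o g)%VF
    end (JW q m)
  end.

(* Main.v *)
(* Every map involved has explicit matrix entries in the basis of words.  For a
   word s with n letters nu_1, let S(s) be the sum of their (1-based) positions.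
   Then F^n x_0 = [n]! sum_s q^(n(n+1)/2 - S(s)) s, and by induction on m the
   (s, t) entry of f_m is [n]! [m-n]! / [m]! q^(n(m+1) - S(s) - S(t)), the sum
   over the middle words being a q-binomial coefficient.  For m = p - 1 one has
   [p-j] = [j], so the factorials cancel, and the same summation shows that the
   entry of the diagram is a multiple, independent of s, t and n, of the entry of
   Phi; the two q-powers agree because q^p = -1. *)
Require Import Defs.
From HB Require Import structures.
From mathcomp Require Import all_boot all_order all_algebra.
From mathcomp Require Import complex reals trigo.
From mathcomp Require Import zify ring.
Set Implicit Arguments.
Unset Strict Implicit.
Unset Printing Implicit Defensive.
Import Order.TTheory GRing.Theory Num.Theory.
Local Open Scope ring_scope.

(** * Matrix entries of linear maps between free spaces *)

Lemma lfun_coordE (k : fieldType) (I J : finType) (f : 'Hom(fvec k I, fvec k J))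
  (v : fvec k I) (y : J) : f v y = \sum_x v x * f (bas k x) y.
Proof.
have {1}-> : v = \sum_x v x *: bas k x.
  apply/ffunP => z; rewrite sum_ffunE (bigD1 z) //= big1 ?addr0.
    by rewrite !ffunE eqxx [RHS]mulr1.
  by move=> x xz; rewrite !ffunE eq_sym (negPf xz) [LHS]mulr0.
rewrite linear_sum sum_ffunE; apply: eq_bigr => x _.
by rewrite linearZ ffunE.
Qed.

Lemma lfun_bas_eq (k : fieldType) (I J : finType) (f g : 'Hom(fvec k I, fvec k J)) :
  (forall x y, f (bas k x) y = g (bas k x) y) -> f = g.
Proof.
move=> fg; apply/lfunP => v; apply/ffunP => y.
by rewrite !lfun_coordE; apply: eq_bigr => x _; rewrite fg.
Qed.

(** * Sums over words of fixed length *)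

Section Tuples.
Variable k : pzRingType.
Implicit Type F : seq bool -> k.

Lemma sum_tuple_cat n m1 m2 F : n = (m1 + m2)%N ->
  \sum_(u : n.-tuple bool) F u =
  \sum_(x : m1.-tuple bool) \sum_(y : m2.-tuple bool) F (x ++ y).
Proof.
move=> ->; rewrite pair_big /=.
pose h (w : m1.-tuple bool * m2.-tuple bool) := [tuple of w.1 ++ w.2].
rewrite (reindex h) //=.
have ht (u : (m1 + m2).-tuple bool) : size (take m1 u) == m1.
  by rewrite size_take size_tuple; case: ltnP => //; lia.
have hd (u : (m1 + m2).-tuple bool) : size (drop m1 u) == m2.
  by rewrite size_drop size_tuple addKn.
exists (fun u => (Tuple (ht u), Tuple (hd u))) => [[x y] _|u _].
  by congr pair; apply: val_inj; rewrite /= ?take_size_cat ?drop_size_cat ?size_tuple.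
by apply: val_inj; rewrite /= cat_take_drop.
Qed.

Lemma sum_tuple0 F : \sum_(u : 0.-tuple bool) F u = F [::].
Proof.
rewrite (big_pred1 [tuple]) // => u /=.
by rewrite [u]tuple0; apply/esym/eqP.
Qed.

Lemma sum_tuple1 F : \sum_(u : 1.-tuple bool) F u = F [:: false] + F [:: true].
Proof.
rewrite (reindex (fun b : bool => [tuple b])) /=.
  by rewrite big_bool addrC.
exists (@thead _ _) => // u _.
by case/tupleP: u => b u; rewrite theadE [u]tuple0; apply: val_inj.
Qed.

Lemma sum_tuple_cons n F : \sum_(u : n.+1.-tuple bool) F u =
  \sum_(u : n.-tuple bool) (F (false :: u) + F (true :: u)).
Proof.
rewrite (sum_tuple_cat (m1 := 1) (m2 := n)) //.
by rewrite (sum_tuple1 (fun x => \sum_(y : n.-tuple bool) F (x ++ y))) big_split.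
Qed.

Lemma sum_tuple_delta n s F : size s = n ->
  \sum_(u : n.-tuple bool) (tval u == s)%:R * F u = F s.
Proof.
move/eqP=> hs; rewrite (bigD1 (Tuple hs)) //= eqxx mul1r big1 ?addr0 // => u.
by rewrite -val_eqE /= => /negPf ->; rewrite mul0r.
Qed.

End Tuples.

(** * Cutting words, and kernels of operators on tensor powers *)

Lemma split_tuple n m r (u : n.-tuple bool) : n = (m + r)%N ->
  exists (s : m.-tuple bool) (z : r.-tuple bool), tval u = s ++ z.
Proof.
move=> nE.
have hs : size (take m u) == m by rewrite size_takel // size_tuple nE leq_addr.
have hz : size (drop m u) == r by rewrite size_drop size_tuple nE addKn.
by exists (Tuple hs), (Tuple hz); rewrite /= cat_take_drop.
Qed.

(* Row convention: M s t is the coefficient of t in the image of s. *)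
Definition kernel_of (k : fieldType) (n : nat) (f : 'End(Xpow k n))
    (M : seq bool -> seq bool -> k) :=
  forall s t : n.-tuple bool, (f (bas k s) : Xpow k n) t = M s t.

Lemma kernel_comp (k : fieldType) n (f g : 'End(Xpow k n)) Mf Mg :
  kernel_of f Mf -> kernel_of g Mg ->
  kernel_of (f \o g)%VF (fun s t => \sum_(u : n.-tuple bool) Mg s u * Mf u t).
Proof.
move=> hf hg s t; rewrite lfunE /= lfun_coordE.
by apply: eq_bigr => u _; rewrite hf hg.
Qed.

Lemma nth_take_drop (T : eqType) (x0 : T) (j a l : nat) (s : seq T) : (l < a)%N ->
  nth x0 (take a (drop j s)) l = nth x0 s (j + l).
Proof. by move=> la; rewrite nth_take // nth_drop. Qed.

Lemma val_window (n j a : nat) (s : n.-tuple bool) : (j + a <= n)%N ->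
  tval (window j a s) = take a (drop j s).
Proof.
move=> jan; apply: (@eq_from_nth _ false).
  by rewrite size_tuple size_take size_drop size_tuple; case: ltnP; lia.
move=> l; rewrite size_tuple => la.
by rewrite -[l]/(val (Ordinal la)) -tnth_nth tnth_mktuple nth_take_drop.
Qed.

Lemma agree_outside (n j a : nat) (s t : n.-tuple bool) : (j + a <= n)%N ->
  [forall l : 'I_n, ((l < j) || (j + a <= l))%N ==> (tnth s l == tnth t l)] =
  (take j s == take j t) && (drop (j + a) s == drop (j + a) t).
Proof.
move=> jan; apply/forallP/andP => [h|[/eqP h1 /eqP h2] l].
  have hn l : (l < n)%N -> ((l < j) || (j + a <= l))%N -> nth false s l = nth false t l.
    move=> ln hl; have /implyP/(_ hl)/eqP := h (Ordinal ln).
    by rewrite !(tnth_nth false).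
  split; apply/eqP/(@eq_from_nth _ false); rewrite ?size_take ?size_drop ?size_tuple //.
    move=> l hl; have lj : (l < j)%N by case: (ltnP j n) hl; lia.
    by rewrite !nth_take // hn ?lj //; lia.
  by move=> l hl; rewrite !nth_drop hn //; lia.
apply/implyP => /orP[lj|jl]; rewrite !(tnth_nth false); apply/eqP.
  by rewrite -(nth_take _ lj) h1 nth_take.
by rewrite -(subnKC jl) -!nth_drop h2.
Qed.

(** Words are plain sequences here, so cutting and concatenating them needs no cast between tuple
    types. The equality test is the identity acting on the strands outside the block. *)
Definition slot_kernel (k : pzRingType) (j a : nat) (M : seq bool -> seq bool -> k)
    (s t : seq bool) : k :=
  ((take j s == take j t) && (drop (j + a) s == drop (j + a) t))%:R *
  M (take a (drop j s)) (take a (drop j t)).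

Lemma kernel_slot (k : fieldType) n j a (f : 'End(Xpow k a)) M : (j + a <= n)%N ->
  kernel_of f M -> kernel_of (slot n j f) (slot_kernel j a M).
Proof.
move=> jan hf s t.
rewrite /slot lext_bas ffunE agree_outside // hf !val_window // /slot_kernel.
by case: ifP => _; rewrite ?mul1r ?mul0r.
Qed.

(** * Position sums, flipped words and nested pairings *)

Fixpoint position_sum (s : seq bool) : nat :=
  if s is b :: s' then (b + position_sum s' + count id s')%N else 0%N.

(** Prepending a letter moves every later [true] one place to the right; this is the summand
    [count id s'] in the recursion. *)
Lemma position_sumE n (s : n.-tuple bool) :
  (\sum_(j < n | tnth s j) j.+1)%N = position_sum s.
Proof.
elim: n s => [|n IHn] s; first by rewrite big_ord0 [s]tuple0.
case/tupleP: s => b s; rewrite /= big_mkcond big_ord_recl tnth0 -IHn.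
have -> : count id s = (\sum_(j < n | tnth s j) 1)%N.
  by rewrite -sum1_count big_tuple.
rewrite -addnA -big_split /= [in RHS]big_mkcond.
congr addn.
by apply: eq_bigr => j _; rewrite tnthS /bump; case: ifP; lia.
Qed.

Lemma position_sum_cat s t :
  position_sum (s ++ t) = (position_sum s + position_sum t + size s * count id t)%N.
Proof.
elim: s => [|b s IHs] /=; first by rewrite mul0n addn0.
by rewrite IHs count_cat mulSn; lia.
Qed.

Lemma position_sum_rcons s b : position_sum (rcons s b) = (position_sum s + b * (size s).+1)%N.
Proof. by rewrite -cats1 position_sum_cat /=; lia. Qed.

(** The only word that nested cups pair nontrivially with [s]: reversed because the pairing is
    nested, negated because a cup kills equal letters. *)
Definition flip (s : seq bool) : seq bool := rev (map negb s).

Lemma size_flip s : size (flip s) = size s.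
Proof. by rewrite size_rev size_map. Qed.

Lemma count_flip s : (count id (flip s) + count id s = size s)%N.
Proof.
rewrite /flip count_rev count_map addnC; exact: (count_predC id).
Qed.

(** A [false] at position j of [s] becomes a [true] at position [size s + 1 - j], and all positions
    of [s] together add up to ['C((size s).+1, 2)]. *)
Lemma position_sum_flip s :
  (position_sum (flip s) + count id s * (size s).+1 = 'C((size s).+1, 2) + position_sum s)%N.
Proof.
elim: s => [|b s IHs] //.
rewrite /flip /= rev_cons position_sum_rcons -/(flip s) size_flip binS bin1.
by case: b => /=; nia.
Qed.
Lemma flip_cons b s : flip (b :: s) = rcons (flip s) (~~ b).
Proof. by rewrite /flip /= rev_cons. Qed.

(** Induction peeling off the innermost pair, formed by the last letter of [x] and the first letter
    of [u]; it is the last factor of the product. *)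
Lemma prod_nested (k : comPzRingType) (w : bool -> bool -> k) r (x u : seq bool) :
  (forall b, w b b = 0) -> size x = r -> size u = r ->
  \prod_(l < r) w (nth false (x ++ u) l) (nth false (x ++ u) (2 * r - 1 - l)) =
  (x == flip u)%:R * (w false true ^+ count id u * w true false ^+ count id (flip u)).
Proof.
move=> w0; elim: r x u => [|r IHr] x u.
  by move=> /size0nil -> /size0nil ->; rewrite big_ord0 /= !expr0 !mulr1.
case/lastP: x => [//|x b]; rewrite size_rcons => -[sx].
case: u => [//|c u] /= [su].
rewrite big_ord_recr /= flip_cons eqseq_rcons.
rewrite !nth_cat !size_rcons !nth_rcons sx eqxx ltnn ltnSn.
have -> : (2 * r.+1 - 1 - r < r.+1)%N = false by lia.
have -> : (2 * r.+1 - 1 - r - r.+1 = 0)%N by lia.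
rewrite /= (eq_bigr (fun l : 'I_r =>
    w (nth false (x ++ u) l) (nth false (x ++ u) (2 * r - 1 - l)))); last first.
  move=> l _; have lr := ltn_ord l.
  rewrite !nth_cat !size_rcons sx !nth_rcons sx lr.
  have -> : (l < r.+1)%N by lia.
  have -> : (2 * r.+1 - 1 - l < r.+1)%N = false by lia.
  have -> : (2 * r - 1 - l < r)%N = false by lia.
  by have -> : (2 * r.+1 - 1 - l - r.+1 = (2 * r - 1 - l - r).+1)%N by lia.
rewrite IHr // -cats1 count_cat /= addn0.
case: (x == flip u); rewrite ?mul0r //= mul1r.
by case: b c => [] [] /=;
  rewrite ?w0 ?mulr0 ?mul0r ?mul1r //= ?addn0 ?add0n ?addn1 ?add1n
  ?exprS; ring.
Qed.

(** * Powers of F on the highest weight vector, and q-binomial sums *)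

Section Action.
Variables (k : fieldType) (q : k).
Hypothesis q0 : q != 0.

(** Read off Delta F = F⊗1 + K^-1⊗F: either the first letter is lowered and the rest kept, or the
    first letter is kept with its K^-1 eigenvalue and F acts further on. *)
Fixpoint Fkernel (s t : seq bool) : k :=
  match s, t with
  | b :: s', c :: t' =>
      (~~ b && c && (s' == t'))%:R
      + (b == c)%:R * (if c then q else q^-1) * Fkernel s' t'
  | _, _ => 0
  end.

Lemma kernel_F n : kernel_of (actF (Xact q n)) Fkernel.
Proof.
elim: n => [|n IHn] s t.
  by rewrite lfunE /= ffunE [s]tuple0.
have h1F : kernel_of (X1F k) (fun s t => (~~ head false s && head false t)%:R).
  move=> u v; case/tupleP: u => b u; case/tupleP: v => c v.
  rewrite /X1F lext_bas theadE [u]tuple0 [v]tuple0 /=.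
  by case: b; case: c => /=; rewrite ffunE ?eqxx.
have h1K : kernel_of (X1K q^-1)
   (fun s t => (head false s == head false t)%:R * (if head false t then q else q^-1)).
  move=> u v; case/tupleP: u => b u; case/tupleP: v => c v.
  rewrite /X1K lext_bas theadE [u]tuple0 [v]tuple0 /= !ffunE -val_eqE /= eqseq_cons andbT.
  by rewrite eq_sym invrK; case: b; case: c; rewrite /= ?mul1r ?mul0r ?mulr1 ?mulr0 ?scaler0 //;
    exact: mulr1.
rewrite /= lfunE /= ffunE (kernel_slot _ h1F) //.
rewrite (kernel_comp (kernel_slot _ h1K) (kernel_slot _ IHn)) // /slot_kernel.
case/tupleP: s => b s; case/tupleP: t => c t /=.
rewrite !drop0 !take0 take_oversize ?size_tuple // add0n add1n.
(* In K^-1⊗F the middle word is forced: F leaves the first letter [b] of the source, and K^-1 leaves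
   the tail [t] of the target. *)
under eq_bigr => u _.
  rewrite (_ : _ * _ = (tval u == b :: t)%:R *
      ((b == c)%:R * (if c then q else q^-1) * Fkernel s t)); last first.
    case/tupleP: u => d u /=; rewrite !take0 !drop0.
    rewrite !drop_oversize ?size_tuple // take_oversize ?size_tuple //.
    rewrite eqxx !eqseq_cons !andbT (eq_sym d b).
    case: eqP => [->|]; rewrite ?mul0r //=.
    by case: eqP => [->|]; rewrite ?mul0r ?mulr0 // !mul1r mulrC.
  over.
rewrite (sum_tuple_delta
  (fun=> (b == c)%:R * (if c then q else q^-1) * Fkernel s t)) /= ?size_tuple //.
by rewrite -natrM mulnb andbC.
Qed.

(** The coefficient of [t] in F^m x_0 divided by [m]!; see [iter_F]. *)
Definition Fweight (m : nat) (t : seq bool) : k :=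
  (count id t == m)%:R * q ^ ('C(m.+1, 2)%:Z - (position_sum t)%:Z).

Hypothesis qV : q - q^-1 != 0.

Lemma sqr_q_neq1 : q * q - 1 != 0.
Proof. by rewrite -[X in _ - X](mulfV q0) -mulrBr mulf_neq0. Qed.

Lemma qint0 : qint q 0 = 0.
Proof. by rewrite /qint expr0 invr1 subrr mul0r. Qed.

Lemma qintS n : qint q n.+1 = q ^- n + q * qint q n.
Proof.
rewrite /qint !exprS; have := expf_neq0 n q0; set x := q ^+ n => x0.
by field; rewrite q0 x0 sqr_q_neq1.
Qed.

Lemma qintD m n : qint q (m + n) = q ^- m * qint q n + q ^+ n * qint q m.
Proof.
rewrite /qint !exprD; have := expf_neq0 n q0; have := expf_neq0 m q0.
set x := q ^+ n => x0; set y := q ^+ m => y0.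
by field; rewrite q0 x0 y0 sqr_q_neq1.
Qed.

Lemma qfact0 : qfact q 0 = 1.
Proof. by rewrite /qfact big_geq. Qed.

Lemma qfactS n : qfact q n.+1 = qfact q n * qint q n.+1.
Proof. by rewrite /qfact big_nat_recr. Qed.

Lemma Fweight_false m t : Fweight m (false :: t) = q ^- m * Fweight m t.
Proof.
rewrite /Fweight /= add0n; case: eqP => [->|]; rewrite ?mul0r ?mulr0 // !mul1r.
rewrite exprnN -expfzDr //; congr (_ ^ _); lia.
Qed.

Lemma Fweight_true m t : Fweight m.+1 (true :: t) = Fweight m t.
Proof.
rewrite /Fweight /= !add1n eqSS; case: eqP => [->|]; rewrite ?mul0r // !mul1r.
congr (_ ^ _); rewrite (binS m.+1) bin1; lia.
Qed.

(** Split on the first letter of [t]. If it is nu_1, either F has just created it or it was there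
    already, and the two contributions add up by [m+1] = q^-m + q [m]. *)
Lemma Fkernel_weight n m (t : n.-tuple bool) :
  \sum_(s : n.-tuple bool) Fweight m s * Fkernel s t =
  qint q m.+1 * Fweight m.+1 t.
Proof.
elim: n m t => [|n IHn] m t.
  rewrite (sum_tuple0 (fun s => Fweight m s * Fkernel s t)) [t]tuple0 /=.
  by rewrite mulr0 /Fweight /= mul0r mulr0.
case/tupleP: t => -[] t.
  rewrite (sum_tuple_cons n (fun s => Fweight m s * Fkernel s (true :: t))) /=.
  rewrite big_split /= Fweight_true qintS mulrDl; congr (_ + _).
    under eq_bigr => s _ do
      rewrite Fweight_false mul0r mul0r addr0 [_ * _%:R]mulrC.
    by rewrite (sum_tuple_delta (fun s => q ^- m * Fweight m s)) ?size_tuple.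
  (* For [m = 0] no source word starts with nu_1, in agreement with [0] = 0. *)
  case: m => [|m].
    rewrite qint0 mulr0 mul0r big1 // => s _.
    by rewrite {1}/Fweight /= mul0r mul0r.
  under eq_bigr => s _ do rewrite Fweight_true add0r mul1r mulrCA.
  by rewrite -mulr_sumr IHn mulrA.
rewrite (sum_tuple_cons n (fun s => Fweight m s * Fkernel s (false :: t))) /=.
under eq_bigr => s _ do
  rewrite Fweight_false add0r mul1r mul0r mul0r addr0 mulr0 addr0 mulrACA.
rewrite -mulr_sumr IHn Fweight_false exprSr invfM; ring.
Qed.

Lemma count_id_eq0 s : (count id s == 0)%N = (s == nseq (size s) false).
Proof. by elim: s => [|[] s IHs] //=; rewrite add0n IHs. Qed.

Lemma position_sum_nseq n : position_sum (nseq n false) = 0%N.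
Proof. by elim: n => //= n ->; rewrite count_nseq mul0n. Qed.

Lemma iter_F n m (t : n.-tuple bool) :
  (iter m (actF (Xact q n)) (xzero k n) : Xpow k n) t = qfact q m * Fweight m t.
Proof.
elim: m t => [|m IHm] t.
  rewrite qfact0 mul1r /= ffunE /Fweight count_id_eq0 -val_eqE /= size_tuple.
  by case: eqP => [->|]; rewrite ?mul0r // position_sum_nseq subrr expr0z mulr1.
rewrite iterS lfun_coordE qfactS -mulrA -Fkernel_weight mulr_sumr.
by apply: eq_bigr => s _; rewrite IHm kernel_F mulrA.
Qed.

(** The elementary symmetric polynomial of degree [a] in q^-2, q^-4, ..., q^(-2m). *)
Definition position_sum_gen (m a : nat) : k :=
  \sum_(x : m.-tuple bool) (count id x == a)%:R * q ^ (- 2 * (position_sum x)%:Z).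

(** A q-Pascal rule: removing the first letter lowers by one each of the [a.+1] positions summed,
    whether that letter is [false] or [true]. *)
Lemma position_sum_gen_cons m a : position_sum_gen m.+1 a.+1 =
  q ^ (- 2 * (a.+1)%:Z) * (position_sum_gen m a.+1 + position_sum_gen m a).
Proof.
rewrite /position_sum_gen (sum_tuple_cons m (fun x => (count id x == a.+1)%:R
  * q ^ (- 2 * (position_sum x)%:Z))) -big_split mulr_sumr /=.
apply: eq_bigr => x _; rewrite !add0n add1n eqSS mulrDr; congr (_ + _).
all: rewrite mulrCA; case: eqP => [->|]; rewrite ?mul0r // !mul1r -expfzDr //.
all: congr (_ ^ _); lia.
Qed.

Lemma position_sum_gen0 m : position_sum_gen m 0 = 1.
Proof.
rewrite /position_sum_gen; transitivity (\sum_(x : m.-tuple bool)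
    (tval x == nseq m false)%:R * (1 : k)); last first.
  by rewrite (sum_tuple_delta (fun=> 1)) ?size_nseq.
apply: eq_bigr => x _; rewrite count_id_eq0 size_tuple.
by case: eqP => [->|]; rewrite ?mul0r // position_sum_nseq mulr0 expr0z.
Qed.

Lemma position_sum_gen_small m a : (m < a)%N -> position_sum_gen m a = 0.
Proof.
move=> ma; rewrite /position_sum_gen big1 // => x _.
have := count_size id x; rewrite size_tuple.
by case: eqP => [->|_]; rewrite ?mul0r // leqNgt ma.
Qed.

(* Counting the a-subsets of {1, ..., a + b} by the sum of their elements gives a
   q-binomial coefficient. *)
Lemma position_sum_genE a b : qfact q a * qfact q b * position_sum_gen (a + b) a =
  q ^ (- (a * (a + b).+1)%:Z) * qfact q (a + b).
Proof.
(* Induction on the total, since the q-Pascal rule leads from (a+1, b+1) to both (a+1, b) and (a,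
   b+1). *)
have [m] := ubnP (a + b); elim: m a b => // m IHm [|a] b.
  by rewrite mul0n oppr0 expr0z position_sum_gen0 qfact0 !mul1r mulr1.
(* For [b = 0] one term of the rule asks for a+1 letters among a places and vanishes. *)
case: b => [|b] abm.
  have := IHm a 0%N; rewrite !addn0 in abm *; rewrite qfact0 !mulr1 => IHa.
  rewrite position_sum_gen_cons position_sum_gen_small // add0r qfactS mulrACA [_ * q ^ _]mulrC.
  rewrite -mulrACA IHa; last by lia.
  have -> : q ^ (- (a.+1 * a.+2)%:Z) = q ^ (- 2 * (a.+1)%:Z) * q ^ (- (a * a.+1)%:Z).
    by rewrite -expfzDr //; congr (_ ^ _); nia.
  ring.
rewrite addSn position_sum_gen_cons.
have IH1 := IHm a.+1 b; have IH2 := IHm a b.+1.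
rewrite addSn -?addnS in IH1; rewrite !addnS in IH1 IH2 abm *.
rewrite ?addSn in IH1 IH2 abm *.
set m' := (a + b).+1 in IH1 IH2 abm *.
transitivity (q ^ (-2 * (a.+1)%:Z) *
   (qint q b.+1 * (qfact q a.+1 * qfact q b * position_sum_gen m' a.+1)
   + qint q a.+1 * (qfact q a * qfact q b.+1 * position_sum_gen m' a))).
  by rewrite !qfactS; ring.
rewrite IH1 ?IH2; try lia.
have -> : q ^ (- (a * m'.+1)%:Z) = q ^ (- (a.+1 * m'.+1)%:Z) * q ^+ m'.+1.
  by rewrite -[q ^+ _]/(q ^ _%:Z) -expfzDr //; congr (_ ^ _); lia.
(* The addition formula for quantum integers is what recombines the two induction hypotheses. *)
have hD : qint q m'.+1 = q ^- a.+1 * qint q b.+1 + q ^+ b.+1 * qint q a.+1.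
  by rewrite -qintD addSn addnS.
rewrite [qfact q m'.+1]qfactS hD.
have -> : q ^ (- (a.+1 * m'.+2)%:Z) = q ^ (- (a.+1 * m'.+1)%:Z) * q ^- a.+1.
  by rewrite exprnN -expfzDr //; congr (_ ^ _); lia.
have -> : q ^ (-2 * (a.+1)%:Z) = q ^- a.+1 * q ^- a.+1.
  by rewrite exprnN -expfzDr //; congr (_ ^ _); lia.
have -> : q ^+ m'.+1 = q ^+ a.+1 * q ^+ b.+1.
  by rewrite -exprD; congr (_ ^+ _); rewrite /m'; lia.
have := expf_neq0 a.+1 q0; set x := q ^+ a.+1 => x0; field.
by rewrite x0.
Qed.
End Action.

(** * Entries of composites of slots, and of the cap-cup diagram between two copies of a map *)

Lemma slot_kernel_cat (k : pzRingType) j a (M : seq bool -> seq bool -> k)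
    (x x' y y' z z' : seq bool) :
  size x = j -> size x' = j -> size y = a -> size y' = a ->
  slot_kernel j a M (x ++ y ++ z) (x' ++ y' ++ z') =
  ((x == x') && (z == z'))%:R * M y y'.
Proof.
move=> hx hx' hy hy'; rewrite /slot_kernel addnC -!drop_drop !take_size_cat //.
by rewrite !drop_size_cat // !take_size_cat.
Qed.

(** Outside the block the entry is a delta, so the sum over whole words collapses to one over the
    block. *)
Lemma slot_kernel_suml (k : comPzRingType) n j a l (M : seq bool -> seq bool -> k) H
    (x y z : seq bool) :
  n = (j + (a + l))%N -> size x = j -> size y = a -> size z = l ->
  \sum_(v : n.-tuple bool) slot_kernel j a M (x ++ y ++ z) v * H (tval v) =
  \sum_(w : a.-tuple bool) M y w * H (x ++ w ++ z).
Proof.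
move=> nE hx hy hz.
pose G v := slot_kernel j a M (x ++ y ++ z) v * H v.
rewrite (sum_tuple_cat G nE) {}/G.
under eq_bigr => x' _.
  rewrite (sum_tuple_cat (fun w => slot_kernel j a M (x ++ y ++ z) (x' ++ w) *
    H (x' ++ w)) (erefl (a + l)%N)).
  under eq_bigr => w _.
    under eq_bigr => z' _.
      rewrite slot_kernel_cat ?size_tuple // (eq_sym x) (eq_sym z) -mulnb natrM.
      rewrite (_ : _ * _ * _ = (tval z' == z)%:R * ((tval x' == x)%:R *
        (M y w * H (x' ++ w ++ z')))); last by ring.
      over.
    rewrite (sum_tuple_delta (fun z' => (tval x' == x)%:R *
      (M y w * H (x' ++ w ++ z'))) hz).
    over.
  rewrite -mulr_sumr; over.
by rewrite (sum_tuple_delta (fun x' => \sum_(w : a.-tuple bool)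
    M y w * H (x' ++ w ++ z)) hx).
Qed.

(** The delta outside the block is symmetric, so transposing [M] reduces this to the previous
    sum. *)
Lemma slot_kernel_sumr (k : comPzRingType) n j a l (M : seq bool -> seq bool -> k) H
    (x y z : seq bool) :
  n = (j + (a + l))%N -> size x = j -> size y = a -> size z = l ->
  \sum_(v : n.-tuple bool) H (tval v) * slot_kernel j a M v (x ++ y ++ z) =
  \sum_(w : a.-tuple bool) H (x ++ w ++ z) * M w y.
Proof.
move=> nE hx hy hz.
under eq_bigr => v _.
  rewrite mulrC (_ : slot_kernel j a M v _ =
    slot_kernel j a (fun s t => M t s) (x ++ y ++ z) v); last first.
    by rewrite /slot_kernel; congr ((_ && _)%:R * _); rewrite eq_sym.
  over.
by rewrite (slot_kernel_suml _ H nE) //; apply: eq_bigr => w _; rewrite mulrC.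
Qed.

Section Sandwich.
Variables (k : fieldType) (q : k).

Definition capcup_kernel m (s t : seq bool) : k :=
  (\prod_(l < m) cup2 q (nth false s l) (nth false s (2 * m - 1 - l))) *
  (\prod_(l < m) cap2 q (nth false t l) (nth false t (2 * m - 1 - l))).

Lemma kernel_capcup m : kernel_of (capcup q m) (capcup_kernel m).
Proof.
move=> s t; rewrite lfunE /= /cups lext_bas /caps.
(* The function inside [caps] is packed as a linear map, so that [lfunE] can evaluate its
   [linfun]. *)
set w : Xpow k (2 * m) := [ffun _ => _]; set c := \prod_(l < m) _.
pose h (c : k^o) : Xpow k (2 * m) := c *: w.
have hlin : linear h by move=> a u v; rewrite /h scalerDl scalerA.
pose hL := GRing.isLinear.Build k k^o (Xpow k (2 * m)) *:%R h hlin.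
pose h' : {linear k^o -> Xpow k (2 * m)} := HB.pack h hL.
by rewrite (lfunE h') !ffunE.
Qed.

(** The cups force the last [r] letters entering them to be [flip z], and the caps force those
    leaving to be [flip z']; only the word [x] on the [j] through strands remains free. *)
Lemma sandwich_kernel n m j r (f : 'End(Xpow k m)) M
    (s t : m.-tuple bool) (z z' : r.-tuple bool) (u v : n.-tuple bool) :
  m = (j + r)%N -> n = (m + r)%N -> tval u = s ++ z -> tval v = t ++ z' ->
  kernel_of f M ->
  ((slot n 0 f \o slot n j (capcup q r) \o slot n 0 f)%VF (bas k u) : Xpow k n) v =
  ((- q) ^+ count id z * ((- 1) ^+ count id z' * q^-1 ^+ count id (flip z'))) *
  \sum_(x : j.-tuple bool) M s (x ++ flip z) * M (x ++ flip z') t.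
Proof.
move=> mE nE uE vE hf.
have h0 : kernel_of (slot n 0 f) (slot_kernel 0 m M).
  by apply: kernel_slot => //; rewrite nE; lia.
have h1 : kernel_of (slot n j (capcup q r)) (slot_kernel j (2 * r) (capcup_kernel r)).
  by apply: kernel_slot (@kernel_capcup r); rewrite nE mE; lia.
rewrite (kernel_comp (kernel_comp h0 h1) h0) uE vE.
rewrite -[s ++ z]/([::] ++ s ++ z) -[t ++ z']/([::] ++ t ++ z').
rewrite (slot_kernel_suml M (fun u => \sum_(v0 : n.-tuple bool)
  slot_kernel j (2 * r) (capcup_kernel r) u v0 *
  slot_kernel 0 m M v0 ([::] ++ t ++ z')) (j := 0) (l := r)) ?size_tuple //.
under eq_bigr => w _ do
  rewrite (slot_kernel_sumr M (fun v => slot_kernel j (2 * r) (capcup_kernel r)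
    ([::] ++ w ++ z) v) (j := 0) (l := r)) ?size_tuple //.
rewrite (sum_tuple_cat (fun w => M s w * (\sum_(w0 : m.-tuple bool)
  slot_kernel j (2 * r) (capcup_kernel r) ([::] ++ w ++ z) ([::] ++ w0 ++ z')
  * M w0 t)) mE) mulr_sumr; apply: eq_bigr => x _ /=.
under eq_bigr => y _ do
  rewrite (sum_tuple_cat (fun w0 => slot_kernel j (2 * r) (capcup_kernel r)
    ((x ++ y) ++ z) (w0 ++ z') * M w0 t) mE).
(* [c1] is the weight of the cups on [flip z ++ z], and [c2] that of the caps on [flip z' ++ z']. *)
pose c1 := (- q) ^+ count id z * 1 ^+ count id (flip z).
pose c2 := (- 1) ^+ count id z' * q^-1 ^+ count id (flip z').
have kE x' (y y' : r.-tuple bool) : size x' = j ->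
    slot_kernel j (2 * r) (capcup_kernel r) ((x ++ y) ++ z) ((x' ++ y') ++ z') =
    (tval x == x')%:R * ((tval y == flip z)%:R * c1 * ((tval y' == flip z')%:R * c2)).
  move=> hx'; have := @slot_kernel_cat k j (2 * r) (capcup_kernel r) x x' (y ++ z)
    (y' ++ z') [::] [::].
  rewrite !cats0 -!catA => -> //; rewrite ?size_cat ?size_tuple ?mul2n ?addnn // andbT.
  rewrite /capcup_kernel !prod_nested ?size_tuple //; try by case.
pose T y x' y' := c1 * c2 * (M s (x ++ y) * M (x' ++ y') t).
(* Three deltas, fixing [y], [x'] and [y'] in turn, leave the sum over [x] alone. *)
transitivity (\sum_(y : r.-tuple bool) (tval y == flip z)%:R *
    \sum_(x' : j.-tuple bool) (tval x' == tval x)%:R *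
      \sum_(y' : r.-tuple bool) (tval y' == flip z')%:R * T y x' y').
  apply: eq_bigr => y _; rewrite !mulr_sumr; apply: eq_bigr => x' _.
  rewrite !mulr_sumr; apply: eq_bigr => y' _; rewrite kE ?size_tuple // eq_sym.
  by rewrite /T; ring.
rewrite (sum_tuple_delta (fun y => \sum_(x' : j.-tuple bool) (tval x' == tval x)%:R *
  \sum_(y' : r.-tuple bool) (tval y' == flip z')%:R * T y x' y'))
  ?size_flip ?size_tuple //.
rewrite (sum_tuple_delta (fun x' => \sum_(y' : r.-tuple bool)
  (tval y' == flip z')%:R * T (flip z) x' y')) ?size_tuple //.
rewrite (sum_tuple_delta (T (flip z) x)) ?size_flip ?size_tuple //.
by rewrite /T /c1 expr1n mulr1 !mulrA.
Qed.

End Sandwich.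

(** * Matrix entries of the Jones-Wenzl projections *)

Definition JW_coef (k : fieldType) (q : k) (m n : nat) : k :=
  qfact q n * qfact q (m - n) / qfact q m.

(** Between words of equal weight the entry factors into a function of [s] times a function of [t];
    this is what makes the composites below computable. *)
Definition JW_kernel (k : fieldType) (q : k) (m : nat) (s t : seq bool) : k :=
  (count id s == count id t)%:R * JW_coef q m (count id s) *
  q ^ ((count id s * m.+1)%:Z - (position_sum s)%:Z - (position_sum t)%:Z).

(** The part of the exponent of q that does not depend on the word [x] on the through strands. *)
Definition sandwich_exp (m r N : nat) (s z t z' : seq bool) : int :=
  (2 * N * m.+1)%:Z + ((count id z + count id z') * m.+1)%:Z
  - (r * (2 * m - r).+2)%:Z - (position_sum (s ++ z))%:Z - (position_sum (t ++ z'))%:Z.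

Section JonesWenzl.
Variables (k : fieldType) (q : k).
Hypothesis q0 : q != 0.
Hypothesis qV : q - q^-1 != 0.

(** Both kernels contain [x], each contributing q^(- [position_sum x]), and weight conservation
    forces [x] to have [N - r] letters nu_1. So the sum over [x] is a value of
    [position_sum_gen]. *)
Lemma sandwich_JW m j r (s t z z' : seq bool) :
  m = (j + r)%N -> size s = m -> size t = m -> size z = r -> size z' = r ->
  let N := count id (s ++ z) in
  ((- q) ^+ count id z * ((- 1) ^+ count id z' * q^-1 ^+ count id (flip z'))) *
  (\sum_(x : j.-tuple bool) JW_kernel q m s (x ++ flip z) * JW_kernel q m (x ++ flip z') t)
  = ((N == count id (t ++ z')) && (r <= N)%N)%:R *
    (JW_coef q m (count id s) * JW_coef q m (count id t)
     * (- 1) ^+ (count id z + count id z')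
     * q ^ sandwich_exp m r N s z t z' * position_sum_gen q j (N - r)).
Proof.
move=> mE hs ht hz hz' N.
have cz := count_flip z; have cz' := count_flip z'.
have pz := position_sum_flip z; have pz' := position_sum_flip z'.
rewrite hz in cz pz; rewrite hz' in cz' pz'.
have NE : N = (count id s + count id z)%N by rewrite /N count_cat.
rewrite count_cat /position_sum_gen !mulr_sumr; apply: eq_bigr => x _.
rewrite /JW_kernel !count_cat !position_sum_cat size_tuple.
(* The two weight conditions at the projections are traded for one on the outer words and one on
   [x]. *)
have hx : (count id s == count id x + count id (flip z))%N &&
  (count id x + count id (flip z') == count id t)%N =
  (N == count id t + count id z')%N && (r <= N)%N && (count id x == N - r)%N.
  by rewrite NE; apply/idP/idP; lia.
have [/andP[/eqP e1 /eqP e2]|/negPf ne] := boolP (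
  (count id s == count id x + count id (flip z))%N &&
  (count id x + count id (flip z') == count id t)%N); last first.
  transitivity (0 : k).
    move: ne; case: (count id s == _)%N => /= [->|_]; first by rewrite !(mul0r, mulr0).
    by rewrite !mul0r mulr0.
  move: ne; rewrite hx; case: (count id x == _)%N; rewrite ?andbF ?andbT; last first.
    by rewrite !(mul0r, mulr0).
  by move=> ->; rewrite mul0r.
move: hx; rewrite (introT eqP e1) (introT eqP e2) => /esym/andP[-> ->] /=.
rewrite !mul1r [(- q) ^+ _]exprNn exprVn exprD e2.
set A := JW_coef _ _ _; set B := JW_coef _ _ _.
transitivity (A * B * ((-1) ^+ count id z * (-1) ^+ count id z') *
  (q ^ (count id z)%:Z * q ^ (- (count id (flip z'))%:Z)
   * q ^ ((count id s * m.+1)%:Z - (position_sum s)%:Z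
     - (position_sum x + position_sum (flip z) + j * count id (flip z))%:Z)
   * q ^ ((count id t * m.+1)%:Z
     - (position_sum x + position_sum (flip z') + j * count id (flip z'))%:Z - (position_sum t)%:Z))).
  by rewrite -exprnP -exprnN; ring.
rewrite -[RHS]mulrA; congr (_ * _); rewrite -!expfzDr //; congr (_ ^ _).
rewrite /sandwich_exp !position_sum_cat hs ht.
have hbin := bin2 r.+1; have hb : ('C(r.+1, 2) * 2 = r.+1 * r)%N.
  by rewrite hbin muln2 halfK oddM /= andNb subn0.
(* Each of [flip z] and [flip z'] brings one binomial coefficient; their sum is r(r+1). *)
have hbZ : ('C(r.+1, 2))%:Z * 2 = (r%:Z + 1) * r%:Z by lia.
have cfE : (count id (flip z))%:Z = r%:Z - (count id z)%:Z by lia.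
have cfE' : (count id (flip z'))%:Z = r%:Z - (count id z')%:Z by lia.
have pfE : (position_sum (flip z))%:Z =
  ('C(r.+1, 2))%:Z + (position_sum z)%:Z - (count id z)%:Z * (r%:Z + 1) by lia.
have pfE' : (position_sum (flip z'))%:Z =
  ('C(r.+1, 2))%:Z + (position_sum z')%:Z - (count id z')%:Z * (r%:Z + 1) by lia.
have csE : (count id s)%:Z = N%:Z - (count id z)%:Z by lia.
have ctE : (count id t)%:Z = N%:Z - (count id z')%:Z by lia.
have -> : (2 * m - r = 2 * j + r)%N by lia.
rewrite -[m.+1]addn1 -[(2 * j + r).+2]addn2 mE !PoszD !PoszM !PoszD cfE cfE' pfE pfE' csE ctE.
apply: subr0_eq; transitivity ((r%:Z + 1) * r%:Z - ('C(r.+1, 2))%:Z * 2); last by rewrite hbZ subrr.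
ring.
Qed.

Lemma qfact_neq0 m : (forall j, (0 < j <= m)%N -> qint q j != 0) -> qfact q m != 0.
Proof.
elim: m => [|m IHm] nz; first by rewrite qfact0 oner_eq0.
rewrite qfactS mulf_neq0 ?nz ?leqnn //; apply: IHm => j /andP[j0 jm].
by rewrite nz // j0 leqW.
Qed.

Lemma JW_coef0 m : qfact q m != 0 -> JW_coef q m 0 = 1.
Proof. by move=> nz; rewrite /JW_coef qfact0 mul1r subn0 divff. Qed.

Lemma JW_coefm m : qfact q m != 0 -> JW_coef q m m = 1.
Proof. by move=> nz; rewrite /JW_coef subnn qfact0 mulr1 divff. Qed.

Lemma position_sum_gen_div e f : qfact q e != 0 -> qfact q f != 0 ->
  position_sum_gen q (e + f) e =
  q ^ (- (e * (e + f).+1)%:Z) * qfact q (e + f) / (qfact q e * qfact q f).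
Proof.
move=> nze nzf; rewrite -position_sum_genE //.
by rewrite mulrAC divff ?mul1r // mulf_neq0.
Qed.

(* The recursion defining f_(l+2), read on entries; the subtracted term is the
   r = 1 case of sandwich_JW. *)
Lemma JW_kernel_rec l (s t : seq bool) (b c : bool) :
  (forall j, (0 < j <= l.+2)%N -> qint q j != 0) ->
  size s = l.+1 -> size t = l.+1 ->
  let N := count id (s ++ [:: b]) in
  JW_kernel q l.+2 (s ++ [:: b]) (t ++ [:: c]) =
  (b == c)%:R * JW_kernel q l.+1 s t - qint q l.+1 / qint q l.+2 *
  (((N == count id (t ++ [:: c])) && (1 <= N)%N)%:R *
    (JW_coef q l.+1 (count id s) * JW_coef q l.+1 (count id t)
     * (- 1) ^+ (b + c)
     * q ^ sandwich_exp l.+1 1 N s [:: b] t [:: c] * position_sum_gen q l (N - 1))).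
Proof.
move=> nz hs ht N; rewrite /JW_kernel -/N.
have nzf j : (j <= l.+2)%N -> qfact q j != 0.
  by move=> hj; apply: qfact_neq0 => i hi; apply: nz; lia.
have NE : N = (count id s + b)%N by rewrite /N count_cat /= addn0.
rewrite (_ : count id (t ++ [:: c]) = (count id t + c)%N); last by rewrite count_cat /= addn0.
clearbody N.
have cs := count_size id s; have ct := count_size id t; rewrite hs in cs; rewrite ht in ct.
have [NN|NN] := eqVneq N (count id t + c)%N; last first.
  rewrite !mul0r mulr0 subr0; case: eqP => [bc|]; last by rewrite mul0r.
  case: eqP => [st|]; last by rewrite !(mul0r, mulr0).
  by move: NN; rewrite NE st bc eqxx.
rewrite /sandwich_exp (_ : 1 * _ = 2 * l + 3)%N; last by lia.
rewrite !position_sum_cat hs ht /= !addn0.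
have [N0|Npos] := posnP N.
  have b0 : b = false by case: b NE => // NE; lia.
  have c0 : c = false by case: c NN => // NN; lia.
  have s0 : count id s = 0%N by lia.
  have t0 : count id t = 0%N by lia.
  rewrite N0 s0 t0 b0 c0 !JW_coef0 ?nzf //= !mul1r mul0r mulr0 subr0.
  by congr (_ ^ _); lia.
have [e Ee] : exists e, N = e.+1 by exists N.-1; lia.
rewrite Ee subn1 /= !mul1r.
(* If all letters are nu_1, the through strands are too few to carry them and the subtracted term is
   zero. *)
have [em|em] := leqP l.+1 e.
  have b1 : b = true by case: b NE => // NE; lia.
  have c1 : c = true by case: c NN => // NN; lia.
  have s1 : count id s = l.+1 by move: NE; rewrite b1; lia.
  have t1 : count id t = l.+1 by rewrite c1 in NN; lia.
  have -> : e = l.+1 by move: NE; rewrite b1; lia.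
  rewrite s1 t1 b1 c1 !JW_coefm ?nzf // position_sum_gen_small // !mulr0 subr0 !eqxx !mul1r.
  by congr (_ ^ _); rewrite /= ?mul1n; lia.
have [f Ef] : exists f, l = (e + f)%N by exists (l - e)%N; lia.
subst l; rewrite position_sum_gen_div ?nzf; try lia.
have A1 : JW_coef q (e + f).+1 e = qfact q e * (qfact q f * qint q f.+1) /
    (qfact q (e + f) * qint q (e + f).+1).
  by rewrite /JW_coef subSn ?leq_addr // addKn !qfactS.
have A2 : JW_coef q (e + f).+1 e.+1 = qfact q e * qint q e.+1 * qfact q f /
    (qfact q (e + f) * qint q (e + f).+1).
  by rewrite /JW_coef subSS addKn !qfactS.
have A3 : JW_coef q (e + f).+2 e.+1 = qfact q e * qint q e.+1 *
    (qfact q f * qint q f.+1) /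
    (qfact q (e + f) * qint q (e + f).+1 * qint q (e + f).+2).
  by rewrite /JW_coef subSS subSn ?leq_addr // addKn !qfactS.
have nze : qfact q e != 0 by apply/nzf/leqW/leqW/leq_addr.
have nzff : qfact q f != 0 by apply/nzf/leqW/leqW/leq_addl.
have nzef : qfact q (e + f) != 0 by apply/nzf/leqW/leqW.
have nz1 : qint q (e + f).+1 != 0 by apply/nz/leqW.
have nz2 : qint q (e + f).+2 != 0 by apply/nz/leqnn.
have nz3 : qint q e.+1 != 0 by apply/nz/leqW/leq_addr.
(* [e+f+2] = q^-(f+1) [e+1] + q^(e+1) [f+1], solved for the power of q: the one relation between
   quantum integers used in the cases [b = c]. *)
have yE : q ^ (- f.+1%:Z) =
    (qint q (e + f).+2 - q ^ e.+1%:Z * qint q f.+1) / qint q e.+1.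
  by rewrite -addSn -addnS addnC (qintD q0 qV) addrK mulfK // exprnN.
case: b c NE NN => [] [] NE NN /=.
(* The exponents become opaque: in each case linear relations among them suffice, and the rest is a
   field identity. *)
all: set Ez := (X in _ * q ^ X = _); set E1 := (X in _ = _ * (_ * q ^ X) - _).
all: set E2 := (X in _ - _ * (_ * q ^ X * _)).
all: set E3 := (X in _ - _ * (_ * (q ^ X * _ / _))).
all: have nzE3 : q ^ E3 != 0 by apply: expfz_neq0.
all: have E2E (d : int) : E2 + E3 = d -> q ^ E2 = q ^ d / q ^ E3
  by move=> <-; rewrite expfzDr // mulfK.
- have sE : count id s = e by apply: succn_inj; rewrite -Ee NE addn1.
  have tE : count id t = e by apply: succn_inj; rewrite -Ee NN addn1.
  have E1z : E1 + (- f.+1%:Z) = Ez.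
    by rewrite /E1 /Ez sE /= ?muln0 ?muln1 ?addn0; clear; lia.
  have E23 : E2 + E3 = E1 + e.+1%:Z.
    by rewrite /E1 /E2 /E3 sE /= ?muln0 ?muln1 ?addn0; clear; lia.
  rewrite sE tE eqxx A1 A3 -E1z (E2E _ E23) !expfzDr // yE /=.
  clearbody E1 E3; field.
  by rewrite nzE3 nze nzff nzef nz1 nz2 nz3.
- have sE : count id s = e by apply: succn_inj; rewrite -Ee NE addn1.
  have tE : count id t = e.+1 by rewrite -Ee NN addn0.
  have E23 : E2 + E3 = Ez.
    by rewrite /E2 /E3 /Ez /= ?muln0 ?muln1 ?addn0; clear; lia.
  rewrite sE tE A1 A2 A3 (E2E _ E23) /=; clearbody Ez E3.
  by field; rewrite nzE3 nze nzff nzef nz1 nz2.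
- have sE : count id s = e.+1 by rewrite -Ee NE addn0.
  have tE : count id t = e by apply: succn_inj; rewrite -Ee NN addn1.
  have E23 : E2 + E3 = Ez.
    by rewrite /E2 /E3 /Ez /= ?muln0 ?muln1 ?addn0; clear; lia.
  rewrite sE tE A1 A2 A3 (E2E _ E23) /=; clearbody Ez E3.
  by field; rewrite nzE3 nze nzff nzef nz1 nz2.
- have sE : count id s = e.+1 by rewrite -Ee NE addn0.
  have tE : count id t = e.+1 by rewrite -Ee NN addn0.
  have E1z : E1 + e.+1%:Z = Ez.
    by rewrite /E1 /Ez sE /= ?muln0 ?muln1 ?addn0; clear; lia.
  have E23 : E2 + E3 = E1 + (- f.+1%:Z).
    by rewrite /E1 /E2 /E3 sE /= ?muln0 ?muln1 ?addn0; clear; lia.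
  rewrite sE tE eqxx A2 A3 -E1z (E2E _ E23) !expfzDr // yE /=.
  clearbody E1 E3; field.
  by rewrite nzE3 nze nzff nzef nz1 nz2 nz3.
Qed.

(** At the root of unity the condition on quantum integers holds up to [m = p - 1], the size
    occurring in the diagram. *)
Lemma kernel_JW m : (forall j, (0 < j <= m)%N -> qint q j != 0) ->
  kernel_of (JW q m) (JW_kernel q m).
Proof.
elim: m => [|[|l] IHm] nz s t.
- rewrite [s]tuple0 [t]tuple0 lfunE /= ffunE eqxx /JW_kernel JW_coef0 ?qfact0 ?oner_eq0 //.
  by rewrite !mul1r expr0z.
- have nzf : qfact q 1 != 0 by rewrite qfact_neq0.
  case/tupleP: s => b s; case/tupleP: t => c t; rewrite [s]tuple0 [t]tuple0.
  rewrite lfunE /= ffunE /JW_kernel -val_eqE /= eqseq_cons andbT eq_sym.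
  by case: b; case: c; rewrite /= ?mul0r // ?JW_coef0 ?JW_coefm ?expr0z ?mulr1.
have hf : kernel_of (JW q l.+1) (JW_kernel q l.+1).
  by apply: IHm => j hj; apply: nz; lia.
have [s' [b sE]] := @split_tuple l.+2 l.+1 1 s (esym (addn1 _)).
have [t' [c tE]] := @split_tuple l.+2 l.+1 1 t (esym (addn1 _)).
have h0 : kernel_of (slot l.+2 0 (JW q l.+1)) (slot_kernel 0 l.+1 (JW_kernel q l.+1)).
  exact: kernel_slot.
have lE : l.+1 = (l + 1)%N by rewrite addn1.
have lE' : l.+2 = (l.+1 + 1)%N by rewrite addn1.
(* The subtracted composite is the sandwich with [j = l] and [r = 1]. *)
rewrite (_ : JW q l.+2 = slot l.+2 0 (JW q l.+1) - (qint q l.+1 / qint q l.+2) *: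
  (slot l.+2 0 (JW q l.+1) \o slot l.+2 l (capcup q 1) \o slot l.+2 0 (JW q l.+1))%VF) //.
rewrite add_lfunE opp_lfunE scale_lfunE !ffunE.
rewrite (sandwich_kernel q lE lE' sE tE hf) (sandwich_JW lE (size_tuple s') (size_tuple t')
  (size_tuple b) (size_tuple c)).
rewrite h0 sE tE -[s' ++ b]cat0s -[t' ++ c]cat0s slot_kernel_cat ?size_tuple //.
case/tupleP: b sE => b b'; rewrite [b']tuple0 => sE.
case/tupleP: c tE => c c'; rewrite [c']tuple0 => tE.
by rewrite /= JW_kernel_rec ?size_tuple // eqseq_cons andbT !addn0.
Qed.
End JonesWenzl.

(** * The root of unity e^(i pi/p) *)

Section RootOfUnity.
Variable R : realType.

Lemma cexpiD (a b : R) : cexpi (a + b) = cexpi a * cexpi b.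
Proof. by rewrite /cexpi cosD sinD; simpc; congr (_ +i* _)%C; rewrite addrC. Qed.

Lemma cexpi0 : cexpi (0 : R) = 1.
Proof. by rewrite /cexpi cos0 sin0. Qed.

Lemma cexpi_natmul (a : R) n : cexpi (a *+ n) = cexpi a ^+ n.
Proof.
by elim: n => [|n IHn]; rewrite ?cexpi0 // mulrS cexpiD IHn exprS.
Qed.

Lemma cexpi_pi_div p : (0 < p)%N -> cexpi (pi / p%:R : R) ^+ p = - 1.
Proof.
move=> p0; rewrite -cexpi_natmul -(mulr_natr (pi / _)) divfK ?pnatr_eq0 -?lt0n //.
by rewrite /cexpi cospi sinpi; apply/eqP; rewrite eq_complex /= oppr0 !eqxx.
Qed.

(** A square root of 1 is real, whereas sin(pi j/p) > 0 for 0 < j < p. *)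
Lemma cexpi_pi_div_sqr_neq1 p j : (0 < j < p)%N ->
  cexpi (pi / p%:R : R) ^+ j ^+ 2 != 1.
Proof.
move=> /andP[j0 jp]; rewrite -cexpi_natmul sqrf_eq1 /cexpi.
have p0 : 0 < p%:R :> R by rewrite ltr0n (ltn_trans j0).
have : sin (pi / p%:R *+ j : R) > 0.
  apply: sin_gt0_pi; apply/andP; split.
    by rewrite pmulrn_lgt0 // divr_gt0 ?pi_gt0.
  by rewrite -(mulr_natr (pi / _)) mulrAC ltr_pdivrMr // ltr_pM2l ?pi_gt0 ?ltr_nat.
move=> /lt0r_neq0 /negPf s0; by rewrite !eq_complex /= oppr0 s0 !andbF.
Qed.

End RootOfUnity.

(** * Comparison of Phi with the diagram over a field with q^p = -1 *)

Section Main.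
Variables (k : fieldType) (q : k) (p : nat).
Hypothesis p2 : (2 <= p)%N.
Hypothesis qp : q ^+ p = - 1.
Hypothesis qj : forall j, (0 < j < p)%N -> q ^+ j ^+ 2 != 1.

Lemma root_neq0 : q != 0.
Proof.
apply/eqP => q0; move: qp; rewrite q0 expr0n gtn_eqF ?(ltnW p2) // => /eqP.
by rewrite eq_sym oppr_eq0 oner_eq0.
Qed.

Let q0 := root_neq0.

Lemma root_subV_neq0 j : (0 < j < p)%N -> q ^+ j - q ^- j != 0.
Proof.
move=> /qj; apply: contraNneq => /eqP; rewrite subr_eq0 => /eqP E.
by rewrite expr2 {1}E mulVf // expf_neq0.
Qed.

Lemma root_qV : q - q^-1 != 0.
Proof. by have := @root_subV_neq0 1%N; rewrite !expr1; apply. Qed.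

Let qV := root_qV.

Lemma qint_neq0 j : (0 < j < p)%N -> qint q j != 0.
Proof. by move=> hj; rewrite /qint mulf_neq0 ?invr_neq0 ?root_subV_neq0. Qed.

(** Since q^(p-j) = -q^-j, the two terms of the numerator are exchanged. *)
Lemma qint_compl j : (j <= p)%N -> qint q (p - j) = qint q j.
Proof.
move=> jp; have nz := expf_neq0 j q0.
have E : q ^+ (p - j) = - q ^- j.
  by apply: (mulIf nz); rewrite -exprD subnK // qp mulNr mulVf.
by rewrite /qint E invrN invrK opprK addrC.
Qed.

(** Passing from [a] to [a.+1] replaces the factor [p-1-a] by [a+1], and these are equal. *)
Lemma qfact_compl a : (a < p)%N -> qfact q a * qfact q (p - 1 - a) = qfact q (p - 1).
Proof.
elim: a => [|a IHa] ap; first by rewrite qfact0 mul1r subn0.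
rewrite -IHa ?(ltnW ap) // (_ : p - 1 - a = (p - 1 - a.+1).+1)%N; last by lia.
rewrite !qfactS -(qint_compl (ltnW ap)) mulrAC -mulrA.
by congr (_ * (_ * qint q _)); lia.
Qed.

Lemma qfact_root_neq0 a : (a < p)%N -> qfact q a != 0.
Proof. by move=> ap; apply: qfact_neq0 => j hj; apply: qint_neq0; lia. Qed.

(** Hence every entry of f_(p-1) is zero or a pure power of q. *)
Lemma JW_coef_root a : (a < p)%N -> JW_coef q (p - 1) a = 1.
Proof.
move=> ap; rewrite /JW_coef qfact_compl // divff // qfact_root_neq0 //; lia.
Qed.

Variable i : nat.
Hypothesis hi : (1 <= i <= p - 1)%N.

(** This is why it suffices to know the projection modulo the span of the a, x and y vectors. *)
Lemma Pnil_Paxy w : w \in Paxy k p i -> Pnil k p i w = 0.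
Proof.
suff /subvP sub : (Paxy k p i <= lker (Pnil k p i))%VS.
  by move=> /sub; rewrite memv_ker => /eqP.
apply/span_subvP => v; rewrite !mem_cat => /or3P[] /mapP[j _ ->];
  rewrite memv_ker /Pnil lextE; apply/eqP/big1 => -[[l|l]|l] _;
  by rewrite ?scaler0 // ffunE scale0r.
Qed.

Lemma Pnil_Pb n : (n < i)%N -> Pnil k p i (Pb k p i n) = Pa k p i n.
Proof.
move=> ni; rewrite /Pnil lextE (bigD1 (inl (inr (Ordinal ni)))) //= big1.
  by rewrite addr0 ffunE eqxx scale1r.
case=> [[l|l]|l] hl; rewrite ?scaler0 // ffunE.
case: eqP => [e|]; last by rewrite scale0r.
by case/eqP: hl; congr (inl (inr _)); apply: val_inj.
Qed.

Let z := (2 * p - i - 1)%N.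

Lemma Phi_entry (pr : 'Hom(Xpow k z, Pplus k p i)) (inc : 'Hom(Pplus k p i, Xpow k z)) :
  is_projection q pr -> is_inclusion q inc ->
  forall u v : z.-tuple bool,
  ((inc \o Pnil k p i \o pr)%VF (bas k u) : Xpow k z) v =
  if (p - i <= count id u <= p - 1)%N
  then proj_coef q p i u * (qfact q (count id u) * Fweight q (count id u) v) else 0.
Proof.
move=> [_ hpr] [_ hinc] u v; rewrite !comp_lfunE.
have /= := hpr u; set b := (X in _ - X \in _) => hb.
have -> : Pnil k p i (pr (bas k u)) = Pnil k p i b.
  by apply/eqP; rewrite -subr_eq0 -linearB; apply/eqP/Pnil_Paxy.
rewrite {hb}/b.
case: ifP => [hn|_]; last by rewrite !linear0 ffunE.
(* With n letters nu_1, b_(n+i-p) goes to a_(n+i-p) and then to F^n x_0; the bound p - i <= n keeps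
   the natural subtractions exact. *)
have [ni nE] : (count id u + i - p < i)%N /\ (count id u + i - p + p - i = count id u)%N.
  by move: (count id u) hn => N hn; split; clear -hi hn; lia.
rewrite linearZ /= Pnil_Pb // linearZ /= hinc // ffunE.
by rewrite nE iter_F.
Qed.

Lemma root_exp2p (a : int) : q ^ (2 * a * p%:Z) = 1.
Proof.
have -> : 2 * a * p%:Z = p%:Z * 2%:Z * a by ring.
by rewrite -!exprz_exp -!exprnP qp sqrrN expr1n exp1rz.
Qed.

(** The ratio of the factorials is ([n]! [p-n-1]! / ([i-1]! [p-i-1]!))^2, in which [n]! [p-n-1]! =
    [p-1]! removes the dependence on n. The minus sign is (-1)^(p-i-1) (-1)^(p-i). *)
Lemma Phi_sandwich (u v : z.-tuple bool) :
  (if (p - i <= count id u <= p - 1)%N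
   then proj_coef q p i u * (qfact q (count id u) * Fweight q (count id u) v) else 0)
  = - (qfact q (p - 1) / (qfact q (i - 1) * qfact q (p - i - 1))) ^+ 2 *
    ((slot z 0 (JW q (p - 1)) \o slot z (i - 1) (capcup q (p - i))
      \o slot z 0 (JW q (p - 1)))%VF (bas k u) : Xpow k z) v.
Proof.
have mE : (p - 1 = (i - 1) + (p - i))%N by lia.
have nE : z = (p - 1 + (p - i))%N by rewrite /z; lia.
have [s [y uE]] := split_tuple u nE; have [t [y' vE]] := split_tuple v nE.
have nzq j : (0 < j <= p - 1)%N -> qint q j != 0.
  by move=> hj; apply: qint_neq0; lia.
rewrite (sandwich_kernel q mE nE uE vE (kernel_JW q0 qV nzq)).
rewrite (sandwich_JW q0 qV mE (size_tuple s) (size_tuple t) (size_tuple y) (size_tuple y')).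
rewrite -uE -vE.
have hcount (x : (p - 1).-tuple bool) : (count id x < p)%N.
  by have := count_size id x; rewrite size_tuple; lia.
rewrite !JW_coef_root // !mul1r /sandwich_exp -uE -vE /proj_coef position_sumE /Fweight.
set N := count id u; rewrite eq_sym.
case: eqP => [NN|_]; last by rewrite !mul0r !mulr0; case: ifP.
have [rN|] := leqP (p - i) N; last by rewrite mul0r mulr0.
(* For N >= p the [i - 1] through strands cannot carry N - (p - i) >= i letters nu_1. *)
have [Np|Np] := leqP N (p - 1); last first.
  by rewrite position_sum_gen_small ?mulr0 //; lia.
rewrite /= !mul1r.
set w := (count id y + count id y')%N.
have [e Ee] : exists e, e = (N - (p - i))%N by eexists.
have [f Ef] : exists f, f = (p - N - 1)%N by eexists.
have jE : (i - 1 = e + f)%N by lia.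
rewrite -Ee -Ef (_ : N + i - p = e)%N; last by lia.
have nzN : qfact q N != 0 by apply: qfact_root_neq0; lia.
have nze : qfact q e != 0 by apply: qfact_root_neq0; lia.
have nzf : qfact q f != 0 by apply: qfact_root_neq0; lia.
have nzi : qfact q (i - 1) != 0 by apply: qfact_root_neq0; lia.
have nzr : qfact q (p - i - 1) != 0 by apply: qfact_root_neq0; lia.
have hP : qfact q (p - 1) = qfact q N * qfact q f.
  rewrite -(@qfact_compl N); first by congr (_ * qfact q _); lia.
  by lia.
rewrite hP.
rewrite [in position_sum_gen _ _ _]jE position_sum_gen_div // -jE.
set E1 := (X in _ * q ^ X * _ * _ = _); set E2 := (X in _ = _ * (_ * q ^ X * _)).
set E3 := (X in _ = _ * (_ * _ * (q ^ X * _ / _))).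
set E4 := (X in _ * (_ * q ^ X) = _).
have signE n : (-1) ^+ n = q ^ (p%:Z * n%:Z) by rewrite -exprz_exp -!exprnP qp.
have [r rE] : exists r, (p - i = r.+1)%N by exists (p - i - 1)%N; lia.
(* Every sign is rewritten as a power of q by (-1)^n = q^(pn). The exponents then agree up to 2pw,
   which is absorbed by q^(2p) = 1. *)
have key : q ^ E1 * q ^ E4 = (-1) ^+ (p - i) * ((-1) ^+ w * q ^ E2 * q ^ E3).
  rewrite !signE -[LHS]mulr1 -(root_exp2p w%:Z) -!expfzDr //; congr (_ ^ _).
  have bE : ('C(N.+1, 2) = 'C(N, 2) + N)%N by rewrite binS bin1.
  rewrite /E1 /E2 /E3 /E4 bE Ee rE.
  have -> : (2 * p - i - 1 = p + r)%N by lia.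
  have -> : ((2 * (p - 1) - r.+1).+2 = p + i)%N by lia.
  have -> : ((i - 1).+1 = i)%N by lia.
  have -> : ((p - 1).+1 = p)%N by lia.
  have pE : p = (i + r.+1)%N by lia.
  have [N' ->] : exists N', N = (N' + r.+1)%N by exists (N - r.+1)%N; lia.
  rewrite addnK pE; clear; move: (position_sum u) (position_sum v) => a b; lia.
rewrite rE subn1 /= in key *; move: key; rewrite exprS mulN1r => key.
have sgn2 : (-1) ^+ r * (-1) ^+ r = 1 :> k by rewrite -expr2 sqrr_sign.
set c := (-1) ^+ r in key sgn2 *.
rewrite rE subn1 /= in nzr.
set A := (X in _ * q ^ E1 * X * _ = _); have -> : c * q ^ E1 * A * (qfact q N * q ^ E4) =
  c * A * qfact q N * (q ^ E1 * q ^ E4) by ring.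
rewrite key (_ : _ * (- c * _) = c * c * (- A * qfact q N *
  ((-1) ^+ w * q ^ E2 * q ^ E3))); last by ring.
rewrite sgn2 /A; clearbody E2 E3 w; field.
by rewrite nze nzf nzi nzr.
Qed.

End Main.

(* The ground field K contains q = e^(i pi/p): K and the field of complex
   numbers are both mapped to a common overfield L, where q is identified with
   e^(i pi/p).  For K the complex numbers, take L = K and identity maps. *)
Theorem corollary4p1 (R : realType) (K L : fieldType)
    (inK : {rmorphism K -> L}) (inC : {rmorphism complex R -> L})
    (p i : nat) (q : K)
    (hp : (2 <= p)%N) (hi : (1 <= i <= p - 1)%N)
    (hq : inK q = inC (cexpi (pi / p%:R)))
    (pr : 'Hom(Xpow K (2 * p - i - 1), Pplus K p i))
    (inc : 'Hom(Pplus K p i, Xpow K (2 * p - i - 1)))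
    (hpr : is_projection q pr) (hinc : is_inclusion q inc)
    (hsummand : (pr \o inc)%VF = \1%VF) :
  exists2 c : K, c != 0 &
    (inc \o Pnil K p i \o pr)%VF =
    c *: (slot (2 * p - i - 1) 0 (JW q (p - 1))
          \o slot (2 * p - i - 1) (i - 1) (capcup q (p - i))
          \o slot (2 * p - i - 1) 0 (JW q (p - 1)))%VF.
Proof.
(* Field morphisms are injective, so both properties of e^(i pi/p) pass through [L] to [q]. *)
have qp : q ^+ p = -1.
  apply: (fmorph_inj inK); rewrite rmorphXn /= hq -rmorphXn /= cexpi_pi_div ?(ltnW hp) //.
  by rewrite !rmorphN1.
have qj j : (0 < j < p)%N -> q ^+ j ^+ 2 != 1.
  move=> /(cexpi_pi_div_sqr_neq1 R); apply: contraNneq => E; apply/eqP.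
  by apply: (fmorph_inj inC); rewrite !rmorphXn /= -hq -!rmorphXn /= E !rmorph1.
(* The constant of [Phi_sandwich]; it is nonzero because its factorials involve only [j] with 0 < j
   < p. *)
exists (- (qfact q (p - 1) / (qfact q (i - 1) * qfact q (p - i - 1))) ^+ 2).
  rewrite oppr_eq0 expf_neq0 // mulf_neq0 ?invr_neq0 ?mulf_neq0 //;
  apply: (qfact_root_neq0 hp qp qj); lia.
apply: lfun_bas_eq => u v; rewrite scale_lfunE ffunE.
by rewrite (Phi_entry hp qp qj hi hpr hinc) (Phi_sandwich hp qp qj hi).
Qed.
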